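(* Let $N\ge1$, $w\ge1$, fix a round $t$, and let $\rho>1$. Let $\hat\epsilon_1,\dots,\hat\epsilon_N$ be privacy budgets with associated deterministic sampling rates $\hat q_1^t,\dots,\hat q_N^t\in(0,1]$ and clipping norms $\hat c_1^t,\dots,\hat c_N^t>0$, and set $q^t=\frac1N\sum_{m=1}^N\hat q_m^t$. Let $\pi$ be a uniformly random permutation of $\{1,\dots,N\}$; client $n$ receives budget $\epsilon_n=\hat\epsilon_{\pi(n)}$, sampling rate $q_n^t=\hat q_{\pi(n)}^t$ and clipping norm $c_n^t=\hat c_{\pi(n)}^t$. For each $n$ let $\Delta\theta_n^t$ be a random vector in $\mathbb{R}^w$ (randomness from the local dataset), independent of $\pi$, with $\mathbb{E}\|\Delta\theta_n^t\|^\rho<\infty$. Conditionally on $\pi$, let $b_n^t\sim\mathrm{Bernoulli}(q_n^t)$ and let $z_n^t,\tilde z_n^t$ be zero-mean Gaussian vectors, all independent of the $\Delta\theta_n^t$. With $\mathrm{clip}(x,c)=x\min(1,c/\|x\|)$, $\Delta\theta^t=\frac1N\sum_n\Delta\theta_n^t$, $$\tilde\Delta\theta^t=\frac1N\sum_{n=1}^N\frac{1}{q^t}\Big(b_n^t\big(\mathrm{clip}(\Delta\theta_n^t,c_n^t)+z_n^t\big)+(1-b_n^t)\tilde z_n^t\Big),$$ and $\mathrm{Error}_t=\Delta\theta^t-\tilde\Delta\theta^t$, we have, with expectation over the local data, client sampling, Gaussian noise and the budget assignment $\pi$, $$\big\|\mathbb{E}[\mathrm{Error}_t]\big\|\le\frac1N\sum_{n=1}^N\mathbb{E}\|\Delta\theta_n^t\|^\rho\cdot\frac1N\sum_{m=1}^N\frac{\hat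 q_m^t}{q^t}\,\frac{1}{(\hat c_m^t)^{\rho-1}}.$$
   Context: Setting: one round of differentially private federated averaging in which privacy budgets (and hence the per-client sampling rate and clipping norm, which depend only on the budget) are assigned to clients at random, independently of their data, each client being equally likely to receive each of the $N$ budgets. Sampled clients send clipped, noised updates; non-sampled clients send pure noise; $q^t$ is the average sampling rate. $\|\cdot\|$ is the Euclidean norm.
   Formalization: Conditionally on π, for each client n the sampling b_n, the noises z_n and z̃_n, and the whole family of updates Δθ are assumed mutually independent (without independence of b_n from the noise the bound can fail); the family Δθ is assumed jointly independent of π. *)

(* Defs.v *)
From HB Require Import structures.
From mathcomp Require Import all_boot all_order all_algebra all_fingroup.
From mathcomp Require Import all_classical all_reals all_analysis.
Set Implicit Arguments. Unset Strict Implicit. Unset Printing Implicit Defensive.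
Import Order.TTheory GRing.Theory Num.Theory.
Local Open Scope classical_set_scope.
Local Open Scope ring_scope.

Section FLDefs.
Context {R : realType}.

Definition enorm {w : nat} (v : 'rV[R]_w) : R := Num.sqrt (\sum_i v 0 i ^+ 2).

Definition clip {w : nat} (v : 'rV[R]_w) (c : R) : 'rV[R]_w :=
  Num.min 1 (c / enorm v) *: v.

Context {d : measure_display} {T : measurableType d}.

Definition condP (P : probability T R) (E A : set T) : R :=
  fine (P (A `&` E)) / fine (P E).

Definition cond_indep_groups (P : probability T R) (E : set T)
  (J G : finType) (gr : J -> G) (X : J -> T -> R) : Prop :=
  forall B : J -> set R, (forall j, measurable (B j)) ->
    condP P E (\bigcap_(j in [set: J]) (X j @^-1` B j)) =
    \prod_(g : G) condP P E (\bigcap_(j in [set j | gr j = g]) (X j @^-1` B j)).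

(* index of the scalar random variables relevant to client n:
   inl (m, i)              : component i of dtheta_m   (group None)
   inr (inl tt)            : b_n                       (group Some None)
   inr (inr (inl i))       : component i of z_n        (group Some (Some true))
   inr (inr (inr i))       : component i of ztilde_n   (group Some (Some false)) *)
Definition cl_index (N w : nat) : finType :=
  (('I_N * 'I_w) + (unit + ('I_w + 'I_w)))%type.

Definition cl_group (N w : nat) (j : cl_index N w) : option (option bool) :=
  match j with
  | inl _ => None
  | inr (inl _) => Some None
  | inr (inr (inl _)) => Some (Some true)
  | inr (inr (inr _)) => Some (Some false)
  end.

Definition cl_family (N w : nat) (dtheta z zt : 'I_N -> T -> 'rV[R]_w)
  (b : 'I_N -> T -> R) (n : 'I_N) (j : cl_index N w) : T -> R :=
  match j with
  | inl (m, i) => fun x => dtheta m x ord0 i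
  | inr (inl _) => b n
  | inr (inr (inl i)) => fun x => z n x ord0 i
  | inr (inr (inr i)) => fun x => zt n x ord0 i
  end.

(* Y : T -> R^w is, under P( . | E), a zero-mean Gaussian vector:
   every linear combination of its components is N(0, sigma^2)
   (possibly degenerate, i.e. a.s. equal to 0). *)
Definition cond_centered_gaussian (P : probability T R) (E : set T) {w : nat}
  (Y : T -> 'rV[R]_w) : Prop :=
  forall a : 'I_w -> R,
    let L := fun x => \sum_i a i * Y x ord0 i in
    (exists sigma : R, sigma != 0 /\
       forall B : set R, measurable B ->
         ((condP P E (L @^-1` B))%:E = normal_prob 0 sigma B)%E)
    \/ condP P E (L @^-1` [set 0]) = 1.

Definition meanvec (P : probability T R) {w : nat} (X : T -> 'rV[R]_w) : 'rV[R]_w :=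
  \row_i fine (\int[P]_x (X x ord0 i)%:E)%E.

End FLDefs.

(* Main.v *)
(* Conditionally on the budget assignment, the Gaussian noise contributes nothing
   to the mean and the Bernoulli factor [b n] only multiplies the mean of the
   clipped update by the sampling rate. As the assignment is uniform and
   independent of the data, the mean error is the average over clients [n] and
   budgets [m], with weights [qh m / qbar], of [E (dtheta n - clip (dtheta n) (ch m))].
   Pairing the mean error [v] with itself and bounding the pairing pointwise by
   [enorm v * (enorm (dtheta n) ^ rho / ch m ^ (rho - 1))] gives
   [enorm v ^ 2 <= enorm v * bound]. *)

Require Import Defs.
From HB Require Import structures.
From mathcomp Require Import all_boot all_order all_algebra all_fingroup.
From mathcomp Require Import all_classical all_reals all_analysis.
From mathcomp Require Import measurable_realfun ring lra.
Import Order.TTheory GRing.Theory Num.Theory.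
Local Open Scope classical_set_scope.
Local Open Scope ring_scope.

(** * Euclidean norm, Cauchy-Schwarz and the pointwise clipping error *)

Section EuclideanNorm.
Context {R : realType} {w : nat}.
Implicit Types u v : 'rV[R]_w.

Lemma enorm_ge0 v : 0 <= enorm v.
Proof. exact: sqrtr_ge0. Qed.

Lemma sqr_enorm v : enorm v ^+ 2 = \sum_i v 0 i ^+ 2.
Proof. by rewrite sqr_sqrtr// sumr_ge0// => i _; exact: sqr_ge0. Qed.

Lemma norm_coord_le_enorm v i : `|v 0 i| <= enorm v.
Proof.
rewrite -sqrtr_sqr ler_wsqrtr// (bigD1 i)//= lerDl sumr_ge0// => j _.
exact: sqr_ge0.
Qed.

Lemma coord_eq0_of_enorm_eq0 v i : enorm v = 0 -> v 0 i = 0.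
Proof.
by move=> v0; apply/eqP; rewrite -normr_le0 -v0 norm_coord_le_enorm.
Qed.

(** Cauchy-Schwarz: summing the squares of [enorm v * u 0 i - enorm u * v 0 i] gives the inequality
    multiplied by [2 * (enorm u * enorm v)]. Cancelling this factor requires both norms to be
    nonzero. *)
Lemma dot_le_enorm u v : \sum_i u 0 i * v 0 i <= enorm u * enorm v.
Proof.
have [u0|u0] := eqVneq (enorm u) 0.
  by rewrite u0 mul0r big1// => i _; rewrite (coord_eq0_of_enorm_eq0 _ _ u0) mul0r.
have [v0|v0] := eqVneq (enorm v) 0.
  by rewrite v0 mulr0 big1// => i _; rewrite (coord_eq0_of_enorm_eq0 _ _ v0) mulr0.
have ua : 0 < enorm u by rewrite lt_neqAle eq_sym u0 enorm_ge0.
have va : 0 < enorm v by rewrite lt_neqAle eq_sym v0 enorm_ge0.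
rewrite -(ler_pM2l (_ : 0 < 2 * (enorm u * enorm v))); last first.
  by rewrite !mulr_gt0.
have -> : 2 * (enorm u * enorm v) * (enorm u * enorm v) =
    \sum_i (enorm v ^+ 2 * u 0 i ^+ 2 + enorm u ^+ 2 * v 0 i ^+ 2).
  by rewrite big_split/= -!mulr_sumr -!sqr_enorm; ring.
rewrite mulr_sumr ler_sum// => i _.
rewrite -subr_ge0.
have -> : enorm v ^+ 2 * u 0 i ^+ 2 + enorm u ^+ 2 * v 0 i ^+ 2 -
   2 * (enorm u * enorm v) * (u 0 i * v 0 i) =
   (enorm v * u 0 i - enorm u * v 0 i) ^+ 2 by ring.
exact: sqr_ge0.
Qed.

Lemma norm_clip_le v (c : R) i : 0 < c -> `|clip v c 0 i| <= c.
Proof.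
move=> c0; rewrite mxE normrM ger0_norm; last first.
  by rewrite le_min ler01 divr_ge0 ?enorm_ge0// ltW.
(* Here [c / enorm v] would be a division by zero, with default value 0; the coordinate itself
   vanishes. *)
have [v0|v0] := eqVneq (enorm v) 0.
  by rewrite (coord_eq0_of_enorm_eq0 _ _ v0) normr0 mulr0 ltW.
apply: (le_trans (ler_wpM2l _ (norm_coord_le_enorm v i))).
  by rewrite le_min ler01 divr_ge0 ?enorm_ge0// ltW.
rewrite -ler_pdivlMr ?ge_min ?lexx ?orbT//.
by rewrite lt_neqAle eq_sym v0 enorm_ge0.
Qed.

(* Only the part of [v] beyond radius [c] is lost, and there
   [enorm v = enorm v ^ rho / enorm v ^ (rho - 1) <= enorm v ^ rho / c ^ (rho - 1)]. *)
Lemma dot_clip_error_le u v (c rho : R) : 1 < rho -> 0 < c ->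
  \sum_i u 0 i * (v 0 i - clip v c 0 i) <=
    enorm u * (enorm v `^ rho / c `^ (rho - 1)).
Proof.
move=> rho1 c0; set r := Num.min 1 (c / enorm v).
have -> : \sum_i u 0 i * (v 0 i - clip v c 0 i) = (1 - r) * \sum_i u 0 i * v 0 i.
  by rewrite mulr_sumr; apply: eq_bigr => i _; rewrite mxE -/r; ring.
have r0 : 0 <= r by rewrite le_min ler01 divr_ge0 ?enorm_ge0// ltW.
have r1 : 0 <= 1 - r by rewrite subr_ge0 ge_min lexx.
apply: (le_trans (ler_wpM2l r1 (dot_le_enorm u v))).
rewrite mulrCA ler_wpM2l ?enorm_ge0//.
have cp : 0 < c `^ (rho - 1) by rewrite powR_gt0.
have [v0|v0] := eqVneq (enorm v) 0.
  by rewrite v0 mulr0 divr_ge0// ?powR_ge0.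
have va : 0 < enorm v by rewrite lt_neqAle eq_sym v0 enorm_ge0.
have [vc|cv] := leP (enorm v) c.
  have -> : r = 1 by apply/min_idPl; rewrite ler_pdivlMr// mul1r.
  by rewrite subrr mul0r divr_ge0// powR_ge0.
apply: (@le_trans _ _ (enorm v)); first by rewrite ler_piMl ?enorm_ge0// lerBlDr lerDl.
rewrite ler_pdivlMr//.
have -> : enorm v `^ rho = enorm v * enorm v `^ (rho - 1).
  rewrite -[in RHS](powRr1 (enorm_ge0 v)) -powRrM mul1r -powRD; last first.
    by rewrite v0 implybT.
  by rewrite addrC subrK.
rewrite ler_wpM2l ?enorm_ge0// ge0_ler_powR ?nnegrE ?ltW// ?subr_gt0//.
Qed.

(** Lets a finite moment of order [rho] control the first moment: inside the unit ball the constant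
    1 suffices, outside it the power increases with its exponent. *)
Lemma enorm_le_powR v (rho : R) : 1 < rho -> enorm v <= 1 + enorm v `^ rho.
Proof.
move=> rho1; have [v1|v1] := leP (enorm v) 1.
  by rewrite (le_trans v1)// lerDl powR_ge0.
rewrite -[leLHS](powRr1 (enorm_ge0 v)) (le_trans (_ : _ <= enorm v `^ rho))//.
  by rewrite ler_powR// ltW.
by rewrite lerDr.
Qed.

End EuclideanNorm.

(** * Change of variables on an event where the law is a scaled measure *)

Section Law.
Context {R : realType} {d d' : measure_display}.
Context {T : measurableType d} {U : measurableType d'}.
Variables (mu : {measure set T -> \bar R}) (D : set T) (mD : measurable D).
Variables (Y : T -> U) (mY : measurable_fun setT Y).
Variables (nu : {measure set U -> \bar R}) (k : {nonneg R}).
Hypothesis lawY : forall B, measurable B ->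
  mu (Y @^-1` B `&` D) = (k%:num%:E * nu B)%E.
Local Open Scope ereal_scope.

(** Restricting [mu] to [D] and pushing it forward along [Y] yields [k] times [nu]. In the
    applications [D] is an event independent of [Y] and [k] is its probability. *)
Lemma ge0_integral_law (f : U -> \bar R) :
  measurable_fun setT f -> (forall y, 0 <= f y) ->
  \int[mu]_(x in D) f (Y x) = k%:num%:E * \int[nu]_y f y.
Proof.
move=> mf f0.
have mfY : measurable_fun setT (f \o Y) by exact: measurableT_comp.
rewrite -ge0_integral_mscale//.
(* The pushforward formula integrates over the whole space; the complement of [D] is null for the
   restricted measure and can be removed. *)
have := ge0_integral_pushforward mY (mrestr mu mD) measurableT mf (fun y _ => f0 y).
rewrite preimage_setT (ge0_negligible_integral (measurableC mD))//=; last first.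
  by rewrite /mrestr setICl measure0.
rewrite setTD setCK => E.
rewrite -(eq_measure_integral _ (_ : forall A, measurable A -> A `<=` D ->
    mrestr mu mD A = mu A)); last by move=> A _ AD; rewrite /= /mrestr setIidl.
rewrite -[LHS]E; apply: eq_measure_integral => A mA _.
by rewrite /= /pushforward /mrestr lawY.
Qed.

Variable f : U -> \bar R.
Hypothesis inu : nu.-integrable setT f.

Lemma integrable_law : mu.-integrable D (f \o Y).
Proof.
have mf := measurable_int nu inu.
apply/integrableP; split.
  by apply: measurable_funTS; exact: measurableT_comp.
rewrite (ge0_integral_law (fun y => `|f y|))//; last exact: measurableT_comp.
by apply: lte_mul_pinfty => //; case/integrableP : inu.
Qed.

Lemma integral_law : \int[mu]_(x in D) f (Y x) = k%:num%:E * \int[nu]_y f y.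
Proof.
have mf := measurable_int nu inu.
rewrite integralE [in RHS]integralE.
rewrite muleBr//; last exact: integrable_add_def.
rewrite -(ge0_integral_law f^\+)//; last exact: measurable_funepos.
rewrite -(ge0_integral_law f^\-)//; last exact: measurable_funeneg.
by rewrite /= funepos_comp funeneg_comp.
Qed.

End Law.

(** * First moment of the centered normal law *)

Section NormalMean.
Context {R : realType} (sigma : R).
Hypothesis sigma0 : sigma != 0.
Local Notation mu := (@lebesgue_measure R).
Local Notation nu := (normal_prob 0 sigma).

(** The Radon-Nikodym derivative of the normal law agrees almost everywhere with the explicit
    density, since both have the same integral over every measurable set. *)
Lemma ge0_integral_normal_prob (f : measurableTypeR R -> \bar R) :
  (forall x, 0 <= f x)%E -> measurable_fun setT f ->
  (\int[nu]_x f x = \int[mu]_x (f x * (normal_pdf 0 sigma x)%:E))%E.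
Proof.
move=> f0 mf.
have dom : (nu : {finite_measure set (measurableTypeR R) -> \bar R}) `<< mu :=
  normal_prob_dominates 0 sigma.
have mpdf : measurable_fun [set: measurableTypeR R]
    (fun x => (normal_pdf 0 sigma x)%:E).
  by apply/measurable_EFinP; exact: measurable_normal_pdf.
have id := Radon_Nikodym_SigmaFinite.f_integrable dom.
rewrite -(Radon_Nikodym_SigmaFinite.change_of_variables dom)//.
apply: ae_eq_integral => //.
- by apply: emeasurable_funM => //; exact: measurable_int id.
- exact: emeasurable_funM.
- apply: ae_eqe_mul2l; apply: integral_ae_eq => // E _ mE.
  by rewrite -Radon_Nikodym_SigmaFinite.f_integral.
Qed.

(* With [u = x^2 / (4 sigma^2)]: [`|x| <= 1 + x^2 <= (1 + 4 sigma^2) expR u], which the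
   density at scale [sigma] absorbs, leaving the density at scale [sqrt 2 * sigma]. *)
Lemma norm_mul_normal_pdf_le x :
  `|x| * normal_pdf 0 sigma x <=
    normal_peak sigma * (1 + 4 * sigma ^+ 2) / normal_peak (Num.sqrt 2 * sigma) *
      normal_pdf 0 (Num.sqrt 2 * sigma) x.
Proof.
have s2 : Num.sqrt 2 * sigma != 0 by rewrite mulf_neq0// sqrtr_eq0 -ltNge.
have p2 := normal_peak_gt0 s2; have p1 := normal_peak_gt0 sigma0.
rewrite !normal_pdfE// !mulrA divfK ?gt_eqF// [`|x| * _]mulrC -!mulrA.
rewrite ler_wpM2l ?normal_peak_ge0//.
rewrite /normal_fun !subr0 exprMn sqr_sqrtr//.
set u := x ^+ 2 / (4 * sigma ^+ 2).
have s20 : 0 < sigma ^+ 2 by rewrite exprn_even_gt0.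
have -> : - x ^+ 2 / (sigma ^+ 2 *+ 2) = - u - u.
  by rewrite /u -mulr_natr; field.
have -> : - x ^+ 2 / (2 * sigma ^+ 2 *+ 2) = - u.
  by rewrite /u -mulr_natr; field.
have u0 : 0 <= u by rewrite divr_ge0 ?sqr_ge0// mulr_ge0// sqr_ge0.
have xu : x ^+ 2 = 4 * sigma ^+ 2 * u by rewrite /u; field.
have xle : `|x| <= 1 + x ^+ 2.
  rewrite -real_normK ?num_real//; have := normr_ge0 x; nra.
have ue : u <= expR u by rewrite (le_trans _ (expR_ge1Dx u))// lerDr.
have e1 : 1 <= expR u by rewrite -expR0 ler_expR.
rewrite expRD [leLHS]mulrA ler_wpM2r ?expR_ge0//.
rewrite expRN ler_pdivrMr ?expR_gt0//; nra.
Qed.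

Lemma integral_norm_normal_prob_lty : (\int[nu]_x `|x%:E| < +oo)%E.
Proof.
rewrite ge0_integral_normal_prob//; last first.
  exact/measurableT_comp.
set c := normal_peak sigma * (1 + 4 * sigma ^+ 2) / normal_peak (Num.sqrt 2 * sigma).
have ic := integrableZl measurableT c (integrable_normal_pdf 0 (Num.sqrt 2 * sigma)).
apply: (le_lt_trans _ (integrable_lty measurableT ic)) => //.
apply: ge0_le_integral => //=.
- by move=> x _; rewrite mule_ge0// lee_fin normal_pdf_ge0.
- apply: emeasurable_funM; last by apply/measurable_EFinP; exact: measurable_normal_pdf.
  exact: measurableT_comp.
- by apply: measurable_funeM; apply/measurable_EFinP; exact: measurable_normal_pdf.
- by move=> x _; rewrite -!EFinM lee_fin norm_mul_normal_pdf_le.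
Qed.

Lemma integrable_id_normal_prob : nu.-integrable setT (fun x => x%:E).
Proof.
apply/integrableP; split; last exact: integral_norm_normal_prob_lty.
exact/measurable_EFinP.
Qed.

(* Evenness of the density gives [E `|x| = 2 E x^+], whence [E x^+ = E x^-]. *)
Lemma integral_id_normal_prob : (\int[nu]_x x%:E = 0)%E.
Proof.
have mid : measurable_fun [set: measurableTypeR R] (fun x : R => x%:E).
  exact/measurable_EFinP.
(* The positive part is the integral over the half-line of the even function [|x|] times the
   density. *)
have posE : (\int[nu]_x (fun x : R => x%:E)^\+ x =
    \int[mu]_(x in [set x | (0 <= x)%R]) (`|x| * normal_pdf 0 sigma x)%:E)%E.
  rewrite ge0_integral_normal_prob//; last exact: measurable_funepos.
  rewrite [RHS]integral_mkcond; apply: eq_integral => x _.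
  rewrite patchE funeposE /= -EFin_max.
  case: ifPn => [/set_mem|/negP/(contra_not (@mem_set _ _ _))] /= x0.
    by rewrite ger0_norm// max_l.
  by rewrite max_r ?mul0e// leNgt; apply/negP => /ltW.
have absE : (\int[nu]_x `|x%:E| = \int[nu]_x (fun x : R => x%:E)^\+ x +
    \int[nu]_x (fun x : R => x%:E)^\- x)%E.
  rewrite -ge0_integralD//; [|exact: measurable_funepos|exact: measurable_funeneg].
  apply: eq_integral => x _.
  by have := congr1 (fun g => g x) (fune_abse (fun x : R => x%:E)).
have absE2 : (\int[nu]_x `|x%:E| = 2%:E * \int[nu]_x (fun x : R => x%:E)^\+ x)%E.
  rewrite posE -ge0_symfun_integralT.
  - by rewrite ge0_integral_normal_prob//; exact: measurableT_comp.
  - by move=> x; rewrite mulr_ge0// normal_pdf_ge0.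
  - move=> x; apply: cvgM; first exact: norm_continuous.
    exact: continuous_normal_pdf.
  - by move=> x; rewrite /= normrN !normal_pdfE// /normal_fun !subr0 sqrrN.
(* Both parts are finite, so the two expressions for the absolute moment can be compared in the
   reals, where they force the parts to be equal. *)
have fp := integrable_pos_fin_num measurableT integrable_id_normal_prob.
have fn := integrable_neg_fin_num measurableT integrable_id_normal_prob.
rewrite integralE; move: absE; rewrite absE2 -(fineK fp) -(fineK fn).
by rewrite -EFinM -EFinD -EFinB => -[E]; congr EFin; lra.
Qed.

End NormalMean.

(** * Measurability and integrability of clipped vectors *)

Section ClipMeasurable.
Context {R : realType} {d : measure_display} {T : measurableType d} {w : nat}.
Variable X : T -> 'rV[R]_w.
Hypothesis mX : forall i, measurable_fun setT (fun x => X x 0 i).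

Lemma measurable_enorm : measurable_fun setT (fun x => enorm (X x)).
Proof.
have -> : (fun x => enorm (X x)) = (fun x => (\sum_i X x 0 i ^+ 2) `^ 2^-1).
  by apply/funext => x; rewrite powR12_sqrt// sumr_ge0// => i _; exact: sqr_ge0.
apply: (measurableT_comp (measurable_powR _)) => //.
by apply: measurable_sum => i; exact: measurable_funX.
Qed.

(** The radius may vary with the sample point because the clipping norm depends on the random
    assignment. Writing the inverse norm as a power with exponent -1 reduces the claim to
    measurability of real powers. *)
Lemma measurable_clip (c : T -> R) i : measurable_fun setT c ->
  measurable_fun setT (fun x => clip (X x) (c x) 0 i).
Proof.
move=> mc.
have -> : (fun x => clip (X x) (c x) 0 i) =
    (fun x => Num.min 1 (c x * enorm (X x) `^ (-1)) * X x 0 i).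
  by apply/funext => x; rewrite mxE powR_inv1// enorm_ge0.
apply: measurable_funM => //; apply: measurable_minr => //.
apply: measurable_funM => //.
by apply: (measurableT_comp (measurable_powR _)); exact: measurable_enorm.
Qed.

Lemma integrable_clip (P : probability T R) (c : R) i : 0 < c ->
  P.-integrable setT (fun x => (clip (X x) c 0 i)%:E).
Proof.
move=> c0; apply: measurable_bounded_integrable => //.
- by rewrite (le_lt_trans (probability_le1 _ _))// ltry.
- exact: measurable_clip.
exists c; split; first exact: num_real.
by move=> M cM x _ /=; rewrite (le_trans (norm_clip_le _ _ _ c0))// ltW.
Qed.

End ClipMeasurable.

(** * The pi-system of rectangles and uniqueness of measures *)

Section Rectangles.
Context {R : realType} {d : measure_display} {T : measurableType d}.
Context {J : finType} (X : J -> T -> R).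
Hypothesis mX : forall j, measurable_fun setT (X j).

(** The independence assumptions speak only of these sets. They form a pi-system generating the
    sigma-algebra of the family [X]. *)
Definition rectangles : set (set T) :=
  [set A | exists2 B : J -> set R, (forall j, measurable (B j)) &
    A = \bigcap_(j in [set: J]) X j @^-1` B j].

Lemma measurable_rectangles : rectangles `<=` measurable.
Proof.
move=> _ [B mB ->]; apply: fin_bigcap_measurable => [|j _].
  exact: finite_finset.
by rewrite -[X in measurable X]setTI; exact: mX.
Qed.

Lemma setI_closed_rectangles : setI_closed rectangles.
Proof.
move=> _ _ [B mB ->] [C mC ->]; exists (fun j => B j `&` C j).
  by move=> j; exact: measurableI.
by rewrite -bigcapI.
Qed.

Lemma measurable_coord_rectangles j :
  measurable_fun [set: g_sigma_algebraType rectangles] (X j).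
Proof.
move=> _ B mB; rewrite setTI; apply: sub_sigma_algebra.
exists (fun k => if k == j then B else setT).
  by move=> k; case: ifP.
apply/seteqP; split=> [x Bx k _ /=|x /(_ j Logic.I)]; last by rewrite /= eqxx.
by case: eqP => [->|].
Qed.

(** Uniqueness of finite measures on a pi-system carries equality on rectangles to every event
    expressed through a function [g] of the family [X]. *)
Lemma measure_eq_rectangles (m1 m2 : {measure set T -> \bar R}) :
  (m1 setT < +oo)%E ->
  (forall A, rectangles A -> m1 A = m2 A) ->
  forall (g : T -> R), measurable_fun [set: g_sigma_algebraType rectangles] g ->
  forall B, measurable B -> m1 (g @^-1` B) = m2 (g @^-1` B).
Proof.
move=> m1oo m12 g mg B mB.
apply: (g_sigma_algebra_measure_unique rectangles _ (fun=> setT)) => //.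
- exact: measurable_rectangles.
- move=> _; exists (fun=> setT) => //; apply/seteqP; split=> //.
- by rewrite bigcup_const//; exists 0%N.
- exact: setI_closed_rectangles.
- by rewrite -[X in _ X]setTI; exact: mg.
Qed.

End Rectangles.

(** * Conditional probabilities, independent pairs of groups, Gaussian coordinates *)

Section ConditionalIndependence.
Context {R : realType} {d : measure_display} {T : measurableType d}.
Variables (P : probability T R) (E : set T).
Hypotheses (mE : measurable E) (PE : P E != 0%E).

Let pE_gt0 : 0 < fine (P E).
Proof.
by rewrite fine_gt0// lt0e PE measure_ge0 (le_lt_trans (probability_le1 _ _))// ltry.
Qed.

Lemma probability_condP A : measurable A ->
  P (A `&` E) = (fine (P E) * condP P E A)%:E.
Proof.
move=> mA; rewrite /condP mulrCA divff ?gt_eqF// mulr1 fineK//.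
by apply: fin_num_measure; exact: measurableI.
Qed.

Lemma condPT : condP P E setT = 1.
Proof. by rewrite /condP setTI divff// gt_eqF. Qed.

Lemma cond_indep_pair (J G : finType) (gr : J -> G) (X : J -> T -> R) (g1 g2 : G)
    (B : J -> set R) :
  cond_indep_groups P E gr X -> g1 != g2 -> (forall j, measurable (B j)) ->
  condP P E (\bigcap_(j in [set j | gr j = g1]) (X j @^-1` B j) `&`
             \bigcap_(j in [set j | gr j = g2]) (X j @^-1` B j)) =
  condP P E (\bigcap_(j in [set j | gr j = g1]) (X j @^-1` B j)) *
  condP P E (\bigcap_(j in [set j | gr j = g2]) (X j @^-1` B j)).
Proof.
move=> ind g12 mB.
(* Every other group is left unconstrained, so its factor in the product is 1. *)
pose B' j := if (gr j == g1) || (gr j == g2) then B j else setT.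
have mB' j : measurable (B' j) by rewrite /B'; case: ifP.
have -> : \bigcap_(j in [set j | gr j = g1]) (X j @^-1` B j) `&`
    \bigcap_(j in [set j | gr j = g2]) (X j @^-1` B j) =
    \bigcap_(j in [set: J]) (X j @^-1` B' j).
  apply/seteqP; split=> [x [h1 h2] j _|x h].
    by rewrite /= /B'; case: ifP => // /orP[/eqP|/eqP]; [exact: h1|exact: h2].
  by split=> j /= jg; have := h j Logic.I; rewrite /= /B' jg eqxx ?orbT.
rewrite ind// (bigD1 g1)//= (bigD1 g2)/=; last by rewrite eq_sym.
rewrite big1 ?mulr1 => [|g /andP[gg1 gg2]].
  congr (_ * _); congr condP; apply: eq_bigcapr => j /= jg.
    by rewrite /B' jg eqxx.
  by rewrite /B' jg eqxx orbT.
rewrite -condPT; congr condP; apply/seteqP; split=> // x _ j /= jg.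
by rewrite /B' jg (negbTE gg1) (negbTE gg2).
Qed.

(** Treats nondegenerate and degenerate noise alike: the conditional law of a coordinate is a normal
    law or the Dirac mass at 0, and either is integrable with mean 0. The coordinate is the linear
    combination whose coefficients are the indicator of [i]. *)
Lemma cond_centered_gaussian_law (w : nat) (Y : T -> 'rV[R]_w) i :
  (forall i, measurable_fun setT (fun x => Y x 0 i)) ->
  cond_centered_gaussian P E Y ->
  exists nu : {measure set (measurableTypeR R) -> \bar R},
    [/\ forall B, measurable B ->
          (condP P E ((fun x => Y x 0 i) @^-1` B))%:E = nu B,
        nu.-integrable setT (fun y => y%:E) &
        (\int[nu]_y y%:E = 0)%E].
Proof.
move=> mY /(_ (fun j => (j == i)%:R)) /=.
have -> : (fun x => \sum_j (j == i)%:R * Y x ord0 j) = (fun x => Y x 0 i).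
  apply/funext => x; rewrite (bigD1 i)//= eqxx mul1r big1 ?addr0// => j.
  by move=> /negbTE ->; rewrite mul0r.
move=> [[sigma [sigma0 lawL]]|Y0].
  exists (normal_prob 0 sigma); split => //.
  - exact: integrable_id_normal_prob.
  - exact: integral_id_normal_prob.
have mid : measurable_fun [set: measurableTypeR R] (fun x : R => x%:E).
  exact/measurable_EFinP.
exists (\d_(0 : measurableTypeR R)); split; last 2 first.
- apply/integrableP; split => //.
  rewrite integral_dirac//; first by rewrite abse0 mule0.
  exact: measurableT_comp.
- by rewrite integral_dirac// mule0.
move=> B mB.
have mYi C : measurable C -> measurable ((fun x => Y x 0 i) @^-1` C).
  by move=> mC; rewrite -[X in measurable X]setTI; exact: mY.
have P0 : P ((fun x => Y x 0 i) @^-1` [set 0] `&` E) = P E.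
  by rewrite probability_condP ?Y0 ?mulr1 ?fineK ?fin_num_measure//; exact: mYi.
(* In the degenerate case, any set containing 0 captures all the mass of [E]; a set avoiding 0 is
   then null, by passing to its complement. *)
have Pin (C : set R) : measurable C -> C 0 -> P ((fun x => Y x 0 i) @^-1` C `&` E) = P E.
  move=> mC C0; apply/eqP; rewrite eq_le; apply/andP; split.
    by apply: le_measure; rewrite ?inE//; apply: measurableI => //; exact: mYi.
  rewrite -[leLHS]P0; apply: le_measure; rewrite ?inE.
  - by apply: measurableI => //; exact: mYi.
  - by apply: measurableI => //; exact: mYi.
  - by apply: setSI => x /= ->.
rewrite /condP /= diracE; have [B0|B0] := boolP ((0 : R) \in B).
  by rewrite Pin ?divff ?gt_eqF//; exact: set_mem.
have -> : (fun x => Y x 0 i) @^-1` B `&` E = E `\` ((fun x => Y x 0 i) @^-1` (~` B)).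
  by apply/seteqP; split=> x /= [h1 h2]; split=> //; exact: contrapT.
rewrite measureD//; last 2 first.
- by apply: mYi; exact: measurableC.
- by rewrite (le_lt_trans (probability_le1 _ _))// ltry.
rewrite [X in (_ - X)%E](_ : _ = P E); first by rewrite subee ?fin_num_measure// mul0r.
rewrite setIC; apply: Pin; first exact: measurableC.
by move=> /mem_set; apply/negP.
Qed.

End ConditionalIndependence.

(** * Integrals for one client under a fixed assignment *)

Section ConditionedClient.
Context {R : realType} {d : measure_display} {T : measurableType d}.
Variables (P : probability T R) (E : set T).
Hypotheses (mE : measurable E) (PE : P E != 0%E).
Context {N w : nat}.
Variables (dtheta z zt : 'I_N -> T -> 'rV[R]_w) (b : 'I_N -> T -> R) (n : 'I_N).
Hypothesis mdtheta : forall m i, measurable_fun setT (fun x => dtheta m x ord0 i).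
Hypothesis mb : measurable_fun setT (b n).
Hypothesis mz : forall i, measurable_fun setT (fun x => z n x ord0 i).
Hypothesis mzt : forall i, measurable_fun setT (fun x => zt n x ord0 i).
Hypothesis ind : cond_indep_groups P E (@cl_group N w) (cl_family dtheta z zt b n).

Let mbv v : measurable (b n @^-1` [set v]).
Proof. by rewrite -[X in measurable X]setTI; exact: mb. Qed.

Let condP_ge0 A : 0 <= condP P E A.
Proof. by rewrite divr_ge0// fine_ge0. Qed.

Let bcapE v (B : cl_index N w -> set R) : B (inr (inl tt)) = [set v] ->
  \bigcap_(j in [set j | @cl_group N w j = Some None])
    (cl_family dtheta z zt b n j @^-1` B j) = b n @^-1` [set v].
Proof.
move=> Bv; apply/seteqP; split=> [x /(_ (inr (inl tt)) erefl)|x bx].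
  by rewrite /= Bv.
by move=> [[]|[[]|[]]]//= _; rewrite Bv.
Qed.

(** By independence, the law of the coordinate on [A] within [E] is its conditional law times a
    constant, so its integral there is a multiple of a zero mean. *)
Lemma integral_noise (Y : T -> 'rV[R]_w) i (A : set T) : measurable A ->
  (forall i, measurable_fun setT (fun x => Y x 0 i)) ->
  cond_centered_gaussian P E Y ->
  (forall B, measurable B -> condP P E ((fun x => Y x 0 i) @^-1` B `&` A) =
     condP P E ((fun x => Y x 0 i) @^-1` B) * condP P E A) ->
  P.-integrable (A `&` E) (fun x => (Y x 0 i)%:E) /\
  (\int[P]_(x in A `&` E) (Y x 0 i)%:E = 0)%E.
Proof.
move=> mA mY gY indY.
have [nu [nuE inu nu0]] := cond_centered_gaussian_law P E mE PE _ _ i mY gY.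
have k0 : 0 <= fine (P E) * condP P E A by rewrite mulr_ge0// fine_ge0.
have mD : measurable (A `&` E) by exact: measurableI.
have mYi : measurable_fun setT ((fun x => Y x 0 i) : T -> measurableTypeR R).
  exact: mY.
have law B : measurable B ->
    P (((fun x => Y x 0 i) : T -> measurableTypeR R) @^-1` B `&` (A `&` E)) =
    ((NngNum k0)%:num%:E * nu B)%E.
  move=> mB; rewrite setIA probability_condP//; last first.
    by apply: measurableI => //; rewrite -[X in measurable X]setTI; exact: mY.
  by rewrite indY// -nuE// -EFinM; congr EFin; rewrite /=; ring.
split; first exact: (integrable_law _ _ mD _ mYi _ _ law _ inu).
by rewrite (integral_law _ _ mD _ mYi _ _ law _ inu) nu0 mule0.
Qed.

Lemma integral_z i v : cond_centered_gaussian P E (z n) ->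
  P.-integrable (b n @^-1` [set v] `&` E) (fun x => (z n x 0 i)%:E) /\
  (\int[P]_(x in b n @^-1` [set v] `&` E) (z n x 0 i)%:E = 0)%E.
Proof.
move=> gz; apply: (integral_noise _ i _ (mbv v)) => // B mB.
(* Only [b n] and the single coordinate [i] of the noise are constrained. *)
pose C (j : cl_index N w) : set R := match j with
  | inr (inl _) => [set v]
  | inr (inr (inl k)) => if k == i then B else setT
  | _ => setT end.
have mC j : measurable (C j).
  by case: j => [[? ?]|[?|[k|?]]] //=; case: ifP.
have := cond_indep_pair P E mE PE _ _ _ _ _ _ _ ind (_ : Some (Some true) != Some None) mC.
rewrite (@bcapE v C erefl).
have -> : \bigcap_(j in [set j | @cl_group N w j = Some (Some true)])
    (cl_family dtheta z zt b n j @^-1` C j) = (fun x => z n x 0 i) @^-1` B.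
  apply/seteqP; split=> [x /(_ (inr (inr (inl i))) erefl)|x zx].
    by rewrite /= eqxx.
  by move=> [[]|[[]|[k|k]]]//= _; case: eqP => // ->.
exact.
Qed.

Lemma integral_zt i v : cond_centered_gaussian P E (zt n) ->
  P.-integrable (b n @^-1` [set v] `&` E) (fun x => (zt n x 0 i)%:E) /\
  (\int[P]_(x in b n @^-1` [set v] `&` E) (zt n x 0 i)%:E = 0)%E.
Proof.
move=> gz; apply: (integral_noise _ i _ (mbv v)) => // B mB.
pose C (j : cl_index N w) : set R := match j with
  | inr (inl _) => [set v]
  | inr (inr (inr k)) => if k == i then B else setT
  | _ => setT end.
have mC j : measurable (C j).
  by case: j => [[? ?]|[?|[k|k]]] //=; case: ifP.
have := cond_indep_pair P E mE PE _ _ _ _ _ _ _ ind (_ : Some (Some false) != Some None) mC.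
rewrite (@bcapE v C erefl).
have -> : \bigcap_(j in [set j | @cl_group N w j = Some (Some false)])
    (cl_family dtheta z zt b n j @^-1` C j) = (fun x => zt n x 0 i) @^-1` B.
  apply/seteqP; split=> [x /(_ (inr (inr (inr i))) erefl)|x zx].
    by rewrite /= eqxx.
  by move=> [[]|[[]|[k|k]]]//= _; case: eqP => // ->.
exact.
Qed.

Hypothesis indE : forall B : 'I_N -> 'I_w -> set R, (forall m i, measurable (B m i)) ->
  P ((\bigcap_(p in [set: ('I_N * 'I_w)%type])
       ((fun x => dtheta p.1 x ord0 p.2) @^-1` B p.1 p.2)) `&` E)
  = (P (\bigcap_(p in [set: ('I_N * 'I_w)%type])
       ((fun x => dtheta p.1 x ord0 p.2) @^-1` B p.1 p.2)) * P E)%E.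

(** Clipping mixes all coordinates through the norm, so independence on rectangles is first extended
    to the sigma-algebra of the updates. Conditional independence then splits off the event on
    [b n], and independence of the data from [E] removes the remaining conditioning. *)
Lemma integral_clip i v c : 0 < c ->
  P.-integrable (b n @^-1` [set v] `&` E) (fun x => (clip (dtheta n x) c 0 i)%:E) /\
  (\int[P]_(x in b n @^-1` [set v] `&` E) (clip (dtheta n x) c 0 i)%:E =
   (fine (P E) * condP P E (b n @^-1` [set v]))%:E *
     \int[P]_x (clip (dtheta n x) c 0 i)%:E)%E.
Proof.
move=> c0.
pose X (p : 'I_N * 'I_w) x := dtheta p.1 x ord0 p.2.
have mX p : measurable_fun setT (X p) by exact: mdtheta.
pose Y x := clip (dtheta n x) c 0 i.
have mY : measurable_fun setT Y by apply: measurable_clip.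
(* Measurability is needed for the smaller sigma-algebra generated by the updates, where uniqueness
   of measures applies. *)
have mYG : measurable_fun [set: g_sigma_algebraType (rectangles X)] Y.
  apply: (@measurable_clip _ _ (g_sigma_algebraType (rectangles X)) _ (dtheta n)) => //.
  by move=> k; exact: (measurable_coord_rectangles X (n, k)).
have mD : measurable (b n @^-1` [set v] `&` E) by exact: measurableI.
have k0 : 0 <= fine (P E) * condP P E (b n @^-1` [set v]).
  by rewrite mulr_ge0// fine_ge0.
have law B : measurable B -> P (Y @^-1` B `&` (b n @^-1` [set v] `&` E)) =
    ((NngNum k0)%:num%:E * P (Y @^-1` B))%E.
  apply: (measure_eq_rectangles X mX (mrestr P mD) (mscale (NngNum k0) P) _ _ Y mYG).
    by rewrite /= /mrestr setTI (le_lt_trans (probability_le1 _ _))// ltry.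
  move=> _ [C mC ->]; rewrite /= /mrestr /mscale /=.
  pose C' (j : cl_index N w) : set R := match j with
    | inl p => C p
    | inr (inl _) => [set v]
    | _ => setT end.
  have mC' j : measurable (C' j) by case: j => [[? ?]|[?|[k|k]]] /=.
  have := cond_indep_pair P E mE PE _ _ _ _ _ _ _ ind (_ : None != Some None) mC'.
  rewrite (@bcapE v C' erefl).
  have -> : \bigcap_(j in [set j | @cl_group N w j = None])
      (cl_family dtheta z zt b n j @^-1` C' j) =
      \bigcap_(p in [set: ('I_N * 'I_w)%type]) X p @^-1` C p.
    apply/seteqP; split=> [x h [m k] _|x h]; first exact: (h (inl (m, k))).
    by move=> [[m k]|[[]|[]]]//= _; exact: (h (m, k)).
  move=> /(_ erefl) indC.
  have mrect : measurable (\bigcap_(p in [set: ('I_N * 'I_w)%type]) X p @^-1` C p).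
    by apply: (measurable_rectangles X mX); exists C.
  rewrite setIA probability_condP//; last exact: measurableI.
  rewrite indC.
  have := indE (fun m k => C (m, k)) (fun m k => mC (m, k)).
  have -> : \bigcap_(p in [set: ('I_N * 'I_w)%type])
      ((fun x => dtheta p.1 x ord0 p.2) @^-1` C (p.1, p.2)) =
      \bigcap_(p in [set: ('I_N * 'I_w)%type]) X p @^-1` C p.
    by apply: eq_bigcapr => -[].
  rewrite (probability_condP P E mE PE)// => h.
  rewrite mulrA EFinM h -muleA muleC; congr (_ * _)%E.
  by rewrite [RHS]EFinM fineK ?fin_num_measure.
have bY : P.-integrable setT (EFin \o Y) by exact: integrable_clip.
have mEFin : measurable_fun [set: R] (@EFin R) by exact/measurable_EFinP.
have iY := integrable_pushforward mY mEFin bY measurableT.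
have pY := integral_pushforward mY mEFin bY measurableT.
(* The reference measure is the unconditional law of [Y]. *)
pose nu : {measure set R -> \bar R} := pushforward P Y.
split; first exact: (integrable_law P _ mD Y mY (nu mY) (NngNum k0) law EFin iY).
by rewrite (integral_law P _ mD Y mY (nu mY) (NngNum k0) law EFin iY) [X in (_ * X)%E]pY.
Qed.

End ConditionedClient.

(* All sums [\sum_s F (s n)] agree, by composing with transpositions;
   averaging over [n] turns each inner sum into [\sum_m F m]. *)
Lemma mean_perm_point (R : numFieldType) (N : nat) (F : 'I_N -> R) (n : 'I_N) :
  (N`!)%:R^-1 * \sum_(s : {perm 'I_N}) F (s n) = N%:R^-1 * \sum_m F m.
Proof.
have N0 : (N%:R : R) != 0 by rewrite pnatr_eq0 -lt0n (leq_ltn_trans _ (ltn_ord n)).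
have F0 : ((N`!)%:R : R) != 0 by rewrite pnatr_eq0 -lt0n fact_gt0.
have shift m : \sum_(s : {perm 'I_N}) F (s m) = \sum_(s : {perm 'I_N}) F (s n).
  rewrite (reindex_inj (mulgI (tperm m n))).
  by apply: eq_bigr => s _; rewrite permM tpermL.
have : \sum_(m < N) \sum_(s : {perm 'I_N}) F (s m) = (N`!)%:R * \sum_m F m.
  rewrite exchange_big/= (eq_bigr (fun=> \sum_m F m)); last first.
    by move=> s _; rewrite [RHS](reindex_inj (@perm_inj _ s)).
  by rewrite sumr_const card_Sn mulr_natl.
under eq_bigr => m _ do rewrite shift.
rewrite sumr_const card_ord => h.
apply: (canLR (mulKf F0)); by rewrite mulrCA -h -[X in _ * X]mulr_natl mulKf.
Qed.

(** * Linear combinations of real-valued integrals *)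

Section FineIntegral.
Context {R : realType} {d : measure_display} {T : measurableType d}.
Variable mu : {measure set T -> \bar R}.

Lemma integrable_linear_comb (I : finType) (a : I -> R) (f : I -> T -> R) :
  (forall k, mu.-integrable setT (fun x => (f k x)%:E)) ->
  mu.-integrable setT (fun x => (\sum_k a k * f k x)%:E).
Proof.
move=> fi.
apply: (@eq_integrable _ _ _ _ _ _ (fun x => \sum_k (a k)%:E * (f k x)%:E)%E) => //.
  by move=> x _; rewrite -sumEFin.
by apply: integrable_sum => // k _; exact: integrableZl.
Qed.

Lemma fine_integral_linear_comb (I : finType) (a : I -> R) (f : I -> T -> R) :
  (forall k, mu.-integrable setT (fun x => (f k x)%:E)) ->
  fine (\int[mu]_x (\sum_k a k * f k x)%:E)%E =
  \sum_k a k * fine (\int[mu]_x (f k x)%:E)%E.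
Proof.
move=> fi.
rewrite (eq_integral (fun x => \sum_k (a k)%:E * (f k x)%:E)%E); last first.
  by move=> x _; rewrite -sumEFin.
rewrite integral_sum//; last by move=> k; exact: integrableZl.
rewrite -sum_fine => [|k _]; last first.
  by rewrite integralZl// fin_numM// integrable_fin_num.
by apply: eq_bigr => k _; rewrite integralZl// fineM// integrable_fin_num.
Qed.

End FineIntegral.

(** * Mean contribution of one client over the random assignment *)

Section Client.
Context {R : realType} {d : measure_display} {T : measurableType d}.
Context {N w : nat}.
Variables (P : probability T R) (qh ch : 'I_N -> R).
Variables (pi : T -> {perm 'I_N}).
Variables (dtheta z zt : 'I_N -> T -> 'rV[R]_w) (b : 'I_N -> T -> R).
Hypothesis ch_gt0 : forall m, 0 < ch m.
Hypothesis mpi : forall s, measurable (pi @^-1` [set s]).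
Hypothesis Ppi : forall s, P (pi @^-1` [set s]) = ((N`!)%:R^-1)%:E.
Hypothesis mdtheta : forall n i, measurable_fun setT (fun x => dtheta n x ord0 i).
Hypothesis mb : forall n, measurable_fun setT (b n).
Hypothesis mz : forall n i, measurable_fun setT (fun x => z n x ord0 i).
Hypothesis mzt : forall n i, measurable_fun setT (fun x => zt n x ord0 i).
Hypothesis indpi : forall (B : 'I_N -> 'I_w -> set R) s,
  (forall n i, measurable (B n i)) ->
  P ((\bigcap_(p in [set: ('I_N * 'I_w)%type])
       ((fun x => dtheta p.1 x ord0 p.2) @^-1` B p.1 p.2)) `&` (pi @^-1` [set s]))
  = (P (\bigcap_(p in [set: ('I_N * 'I_w)%type])
       ((fun x => dtheta p.1 x ord0 p.2) @^-1` B p.1 p.2)) * P (pi @^-1` [set s]))%E.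
Hypothesis b1 : forall s n, condP P (pi @^-1` [set s]) (b n @^-1` [set 1]) = qh (s n).
Hypothesis b0 : forall s n, condP P (pi @^-1` [set s]) (b n @^-1` [set 0]) = 1 - qh (s n).
Hypothesis gz : forall s n, cond_centered_gaussian P (pi @^-1` [set s]) (z n).
Hypothesis gzt : forall s n, cond_centered_gaussian P (pi @^-1` [set s]) (zt n).
Hypothesis ind : forall s n, cond_indep_groups P (pi @^-1` [set s]) (@cl_group N w)
                 (cl_family dtheta z zt b n).

Let Ppi_neq0 s : P (pi @^-1` [set s]) != 0%E.
Proof. by rewrite Ppi eqe invr_eq0 pnatr_eq0 -lt0n fact_gt0. Qed.

Let mbv n v : measurable (b n @^-1` [set v]).
Proof. by rewrite -[X in measurable X]setTI; exact: mb. Qed.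

(** On each event [pi = s] the point masses at 1 and 0 add up to the full conditional mass; there
    are finitely many such events and they cover the space. *)
Lemma ae_bernoulli n : {ae P, forall x, b n x = 1 \/ b n x = 0}.
Proof.
have : {ae P, forall x, forall s : {perm 'I_N}, pi x = s -> b n x = 1 \/ b n x = 0}.
  apply: filter_forall => s.
  set E := pi @^-1` [set s]; have mE : measurable E := mpi s.
  exists (E `\` ((b n @^-1` [set 1] `|` b n @^-1` [set 0]) `&` E)); split.
  - by apply: measurableD => //; apply: measurableI => //; exact: measurableU.
  - rewrite measureD//; [|by apply: measurableI => //; exact: measurableU|].
      rewrite setIC -setIA setIid.
      rewrite [X in (_ - X)%E](_ : _ = P E); first by rewrite subee ?fin_num_measure.
      rewrite setIUl measureU; [|exact: measurableI|exact: measurableI|].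
        rewrite [in LHS]/= !(probability_condP _ _ (mpi s) (Ppi_neq0 s))// b1 b0.
        by rewrite -EFinD -mulrDr addrC subrK mulr1 fineK ?fin_num_measure.
      apply/seteqP; split=> // x /= [[h1 _] [h0 _]].
      by have := oner_neq0 R; rewrite -h1 h0 eqxx.
    by rewrite (le_lt_trans (probability_le1 _ _))// ltry.
  - move=> x /= /not_implyP[xs h]; split=> //.
    by move=> [h' _]; exact: h.
by apply: filterS => x /(_ (pi x) erefl).
Qed.

Definition client_update n x : 'rV[R]_w :=
  b n x *: (clip (dtheta n x) (ch (pi x n)) + z n x) + (1 - b n x) *: zt n x.

Lemma measurable_client_update n i :
  measurable_fun setT (fun x => client_update n x 0 i).
Proof.
have mch : measurable_fun setT (fun x => ch (pi x n)).
  (* Measurability is known only for the events [pi = s], hence the expansion into a finite sum of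
     indicators. *)
  have -> : (fun x => ch (pi x n)) =
      (fun x => \sum_(s : {perm 'I_N}) ch (s n) * \1_(pi @^-1` [set s]) x).
    apply/funext => x; rewrite (bigD1 (pi x))//= indicE mem_set//= mulr1.
    rewrite big1 ?addr0// => s sx; rewrite indicE memNset ?mulr0//= => h.
    by rewrite h eqxx in sx.
  by apply: measurable_sum => s; apply: measurable_funM.
have -> : (fun x => client_update n x 0 i) = (fun x =>
    b n x * (clip (dtheta n x) (ch (pi x n)) 0 i + z n x 0 i) +
    (1 - b n x) * zt n x 0 i) by apply/funext => x; rewrite !mxE.
apply: measurable_funD; apply: measurable_funM => //.
  by apply: measurable_funD => //; exact: measurable_clip.
exact: measurable_funB.
Qed.

(** The update is cut along the events given by [b n] and [pi], with extension by zero. On each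
    piece the clipping norm is constant. *)
Let clip_part n i (s : {perm 'I_N}) : T -> \bar R :=
  (fun x => (clip (dtheta n x) (ch (s n)) 0 i)%:E)
    \_ (b n @^-1` [set 1] `&` pi @^-1` [set s]).
Let z_part n i (s : {perm 'I_N}) : T -> \bar R :=
  (fun x => (z n x 0 i)%:E) \_ (b n @^-1` [set 1] `&` pi @^-1` [set s]).
Let zt_part n i (s : {perm 'I_N}) : T -> \bar R :=
  (fun x => (zt n x 0 i)%:E) \_ (b n @^-1` [set 0] `&` pi @^-1` [set s]).

Let client_update_ae n i : ae_eq P setT (fun x => (client_update n x 0 i)%:E)
  (fun x => \sum_s (clip_part n i s x + (z_part n i s x + zt_part n i s x)))%E.
Proof.
apply: filterS (ae_bernoulli n) => x hx _.
rewrite (bigD1 (pi x))//= big1 ?adde0; last first.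
  move=> s /eqP sx; rewrite /clip_part /z_part /zt_part !patchE !memNset ?adde0//;
    by move=> -[_ /= h]; apply: sx.
have inb v : (x \in b n @^-1` [set v] `&` pi @^-1` [set pi x]) = (b n x == v).
  by apply/idP/eqP => [/set_mem[]//|bv]; exact/mem_set.
rewrite /clip_part /z_part /zt_part !patchE !inb /client_update !mxE.
case: hx => ->.
  by rewrite eqxx oner_eq0 subrr mul0r mul1r adde0 addr0.
by rewrite [0 == 1]eq_sym oner_eq0 eqxx subr0 mul0r mul1r !add0e add0r.
Qed.

Let integrable_parts n i s : [/\ P.-integrable setT (clip_part n i s),
  P.-integrable setT (z_part n i s) & P.-integrable setT (zt_part n i s)].
Proof.
have mD v : measurable (b n @^-1` [set v] `&` pi @^-1` [set s]).
  exact: measurableI.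
split; apply/(integrable_mkcond _ (mD _)).
- by have [] := integral_clip P _ (mpi s) (Ppi_neq0 s) _ _ _ _ n mdtheta (mb n)
    (ind s n) (fun B => indpi B s) i 1 _ (ch_gt0 (s n)).
- by have [] := integral_z P _ (mpi s) (Ppi_neq0 s) _ _ _ _ n (mb n)
    (mz n) (ind s n) i 1 (gz s n).
- by have [] := integral_zt P _ (mpi s) (Ppi_neq0 s) _ _ _ _ n (mb n)
    (mzt n) (ind s n) i 0 (gzt s n).
Qed.

Lemma integrable_client_update n i :
  P.-integrable setT (fun x => (client_update n x 0 i)%:E).
Proof.
have mu := measurable_client_update n i.
have iV : P.-integrable setT
    (fun x => \sum_s (clip_part n i s x + (z_part n i s x + zt_part n i s x)))%E.
  apply: integrable_sum => // s _; have [? ? ?] := integrable_parts n i s.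
  by apply: integrableD => //; exact: integrableD.
(* Integrability passes from the sum of pieces to the update through almost everywhere equality of
   absolute values. *)
apply/integrableP; split; first exact/measurable_EFinP.
have [mV] := integrableP _ _ _ iV; apply: le_lt_trans.
rewrite (ae_eq_integral _ _ _ _ _ (ae_eq_abse (client_update_ae n i)))//.
- by apply: measurableT_comp => //; exact/measurable_EFinP.
- exact: measurableT_comp.
Qed.

(** Each permutation [s] has weight [1 / N!] and contributes [qh (s n)] times the mean update
    clipped at [ch (s n)], the noise integrating to 0; averaging over [s] makes the budget of client
    [n] uniform. *)
Lemma integral_client_update n i :
  fine (\int[P]_x (client_update n x 0 i)%:E)%E =
  N%:R^-1 * \sum_m qh m * fine (\int[P]_x (clip (dtheta n x) (ch m) 0 i)%:E)%E.
Proof.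
have mu := measurable_client_update n i.
have part s := integrable_parts n i s.
have iV s : P.-integrable setT
    (fun x => clip_part n i s x + (z_part n i s x + zt_part n i s x))%E.
  have [? ? ?] := part s.
  by apply: integrableD => //; exact: integrableD.
rewrite (ae_eq_integral _ _ _ _ _ (client_update_ae n i))//; last 2 first.
- exact/measurable_EFinP.
- by apply: emeasurable_sum => s; exact: (measurable_int P (iV s)).
rewrite integral_sum//.
rewrite -(@mean_perm_point _ _ (fun m =>
  qh m * fine (\int[P]_x (clip (dtheta n x) (ch m) 0 i)%:E)%E) n).
rewrite mulr_sumr -sum_fine => [|s _]; last exact: integrable_fin_num.
apply: eq_bigr => s _; have [? ? ?] := part s.
rewrite integralD//; last exact: integrableD.
rewrite integralD// /clip_part /z_part /zt_part -!integral_mkcond.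
have [_ ->] := integral_clip P _ (mpi s) (Ppi_neq0 s) _ _ _ _ n mdtheta (mb n)
    (ind s n) (fun B => indpi B s) i 1 _ (ch_gt0 (s n)).
have [_ ->] := integral_z P _ (mpi s) (Ppi_neq0 s) _ _ _ _ n (mb n)
    (mz n) (ind s n) i 1 (gz s n).
have [_ ->] := integral_zt P _ (mpi s) (Ppi_neq0 s) _ _ _ _ n (mb n)
    (mzt n) (ind s n) i 0 (gzt s n).
rewrite !adde0 b1 Ppi /=.
by rewrite fineM ?mulrA// integrable_fin_num//; exact: integrable_clip.
Qed.

End Client.

(** * Assembling the bound on the norm of the mean error *)

Theorem mainTheorem4 (R : realType) (d : measure_display) (T : measurableType d)
  (P : probability T R) (N w : nat) (rho : R)
  (qh ch : 'I_N -> R)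
  (pi : T -> {perm 'I_N})
  (dtheta z zt : 'I_N -> T -> 'rV[R]_w) (b : 'I_N -> T -> R) :
  (0 < N)%N -> (0 < w)%N -> 1 < rho ->
  (forall m, 0 < qh m <= 1) -> (forall m, 0 < ch m) ->
  (* pi is a uniformly random permutation *)
  (forall s, measurable (pi @^-1` [set s])) ->
  (forall s, P (pi @^-1` [set s]) = ((N`!)%:R^-1)%:E) ->
  (* measurability of the random quantities *)
  (forall n i, measurable_fun setT (fun x => dtheta n x ord0 i)) ->
  (forall n, measurable_fun setT (b n)) ->
  (forall n i, measurable_fun setT (fun x => z n x ord0 i)) ->
  (forall n i, measurable_fun setT (fun x => zt n x ord0 i)) ->
  (* local updates are independent of pi *)
  (forall (B : 'I_N -> 'I_w -> set R) s, (forall n i, measurable (B n i)) ->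
     P ((\bigcap_(p in [set: ('I_N * 'I_w)%type])
          ((fun x => dtheta p.1 x ord0 p.2) @^-1` B p.1 p.2)) `&` (pi @^-1` [set s]))
     = (P (\bigcap_(p in [set: ('I_N * 'I_w)%type])
          ((fun x => dtheta p.1 x ord0 p.2) @^-1` B p.1 p.2)) * P (pi @^-1` [set s]))%E) ->
  (* E ||dtheta_n||^rho < oo *)
  (forall n, P.-integrable setT (fun x => (powR (enorm (dtheta n x)) rho)%:E)) ->
  (* conditionally on pi = s: b_n ~ Bernoulli(q_n), z_n, zt_n zero-mean Gaussian,
     and (dtheta, b_n, z_n, zt_n) mutually independent *)
  (forall s n, condP P (pi @^-1` [set s]) (b n @^-1` [set 1]) = qh (s n)) ->
  (forall s n, condP P (pi @^-1` [set s]) (b n @^-1` [set 0]) = 1 - qh (s n)) ->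
  (forall s n, cond_centered_gaussian P (pi @^-1` [set s]) (z n)) ->
  (forall s n, cond_centered_gaussian P (pi @^-1` [set s]) (zt n)) ->
  (forall s n, cond_indep_groups P (pi @^-1` [set s]) (@cl_group N w)
                 (cl_family dtheta z zt b n)) ->
  let qbar := N%:R^-1 * \sum_m qh m in
  let Error := fun x =>
    N%:R^-1 *: \sum_n dtheta n x
    - N%:R^-1 *: \sum_n qbar^-1 *:
        (b n x *: (clip (dtheta n x) (ch (pi x n)) + z n x)
         + (1 - b n x) *: zt n x) in
  enorm (meanvec P Error) <=
    (N%:R^-1 * \sum_n fine (\int[P]_x (powR (enorm (dtheta n x)) rho)%:E)%E)
    * (N%:R^-1 * \sum_m (qh m / qbar) / powR (ch m) (rho - 1)).
Proof.
move=> N0 w0 rho1 qh01 ch0 mpi Ppi mdtheta mb mz mzt indpi irho b1 b0 gz gzt ind.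
cbv zeta; set qbar := N%:R^-1 * \sum_m qh m; set Error := (X in meanvec P X).
have Nr : (N%:R : R) != 0 by rewrite pnatr_eq0 -lt0n.
have qbar0 : 0 < qbar.
  rewrite mulr_gt0 ?invr_gt0 ?ltr0n// (bigD1 (Ordinal N0))//= ltr_pwDl//.
    by case/andP: (qh01 (Ordinal N0)).
  by apply: sumr_ge0 => m _; case/andP: (qh01 m) => /ltW.
have idth n i : P.-integrable setT (fun x => (dtheta n x 0 i)%:E).
  have i1 : P.-integrable setT (fun x => 1%:E + (enorm (dtheta n x) `^ rho)%:E)%E.
    by apply: integrableD => //; exact: finite_measure_integrable_cst.
  apply: le_integrable i1 => //; first exact/measurable_EFinP.
  move=> x _; rewrite -EFinD !abse_EFin lee_fin [leRHS]ger0_norm.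
    by rewrite (le_trans (norm_coord_le_enorm _ _))// enorm_le_powR.
  by rewrite addr_ge0// powR_ge0.
pose U := client_update ch pi dtheta z zt b.
have iU n i : P.-integrable setT (fun x => (U n x 0 i)%:E).
  exact: (integrable_client_update P qh ch pi).
have iclip n m i : P.-integrable setT (fun x => (clip (dtheta n x) (ch m) 0 i)%:E).
  exact: integrable_clip.
pose A n i : R := fine (\int[P]_x (dtheta n x 0 i)%:E)%E.
pose C n m i : R := fine (\int[P]_x (clip (dtheta n x) (ch m) 0 i)%:E)%E.
have UE n i : fine (\int[P]_x (U n x 0 i)%:E)%E = N%:R^-1 * \sum_m qh m * C n m i.
  exact: (integral_client_update P qh ch pi).
set v := meanvec P Error.
have vE i : v 0 i = N%:R^-1 * \sum_n N%:R^-1 * \sum_m (qh m / qbar) * (A n i - C n m i).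
  (* The error is one linear combination over two copies of the clients: true updates on the left,
     noised ones on the right. *)
  pose a (k : 'I_N + 'I_N) : R := match k with
    | inl _ => N%:R^-1 | inr _ => - (N%:R^-1 * qbar^-1) end.
  pose f (k : 'I_N + 'I_N) x : R := match k with
    | inl n => dtheta n x 0 i | inr n => U n x 0 i end.
  have fi k : P.-integrable setT (fun x => (f k x)%:E).
    by case: k => n; [exact: idth|exact: iU].
  rewrite mxE (_ : (fun x => (Error x ord0 i)%:E) = (fun x => (\sum_k a k * f k x)%:E)).
    rewrite fine_integral_linear_comb// big_sumType/=.
    rewrite -!mulr_sumr -/(A _ i).
    under [X in _ + _ * X]eq_bigr do rewrite UE.
    rewrite mulNr -mulrA -mulrBr; congr (_ * _).
    rewrite !mulr_sumr -sumrB; apply: eq_bigr => n _.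
    have -> : \sum_m (qh m / qbar) * (A n i - C n m i) =
        N%:R * A n i - qbar^-1 * \sum_m qh m * C n m i.
      (* The weights [qh m / qbar] sum to [N]; this normalisation lets the true mean be spread over
         the budgets and paired with each clipped mean. *)
      have -> : N%:R = qbar^-1 * \sum_m qh m.
        rewrite /qbar invfM invrK -mulrA mulVf ?mulr1//.
        by move: qbar0; apply: contraTneq => S0; rewrite /qbar S0 mulr0 ltxx.
      rewrite -mulrA -mulrBr mulr_suml -sumrB mulr_sumr.
      by apply: eq_bigr => m _; ring.
    by rewrite mulrBr mulKf// [in RHS]mulrCA.
  apply/funext => x; congr EFin.
  rewrite !mxE !summxE big_sumType/= -!mulr_sumr mulNr -mulrA; congr (_ - _ * _).
  by rewrite mulr_sumr; apply: eq_bigr => n _; rewrite mxE.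
have vv : enorm v ^+ 2 = N%:R^-1 * \sum_n N%:R^-1 * \sum_m (qh m / qbar) *
    \sum_i v 0 i * (A n i - C n m i).
  rewrite sqr_enorm (eq_bigr (fun i => N%:R^-1 * \sum_n N%:R^-1 * \sum_m (qh m / qbar) *
      (v 0 i * (A n i - C n m i)))) => [|i _].
    rewrite -[LHS]mulr_sumr [in LHS]exchange_big/=; congr (_ * _); apply: eq_bigr => n _.
    rewrite -[LHS]mulr_sumr [in LHS]exchange_big/=; congr (_ * _); apply: eq_bigr => m _.
    by rewrite -[LHS]mulr_sumr.
  (* Only one of the two factors is expanded; the other stays as the vector paired with the
     error. *)
  rewrite expr2 {2}vE mulrCA; congr (_ * _); rewrite mulr_sumr; apply: eq_bigr => n _.
  rewrite mulrCA; congr (_ * _); rewrite mulr_sumr; apply: eq_bigr => m _.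
  by rewrite mulrCA.
have dotE n m : \sum_i v 0 i * (A n i - C n m i) <=
    enorm v * (fine (\int[P]_x (enorm (dtheta n x) `^ rho)%:E)%E / ch m `^ (rho - 1)).
  have iD i : P.-integrable setT
      (fun x => (dtheta n x 0 i - clip (dtheta n x) (ch m) 0 i)%:E).
    have := integrableB measurableT (idth n i) (iclip n m i).
    by apply: eq_integrable => // x _; rewrite EFinB.
  (* As [v] is deterministic, the pairing moves inside the expectation, where the pointwise clipping
     bound applies. *)
  have -> : \sum_i v 0 i * (A n i - C n m i) = fine (\int[P]_x
      (\sum_i v 0 i * (dtheta n x 0 i - clip (dtheta n x) (ch m) 0 i))%:E)%E.
    rewrite fine_integral_linear_comb//; apply: eq_bigr => i _; congr (_ * _).
    under eq_integral do rewrite EFinB.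
    rewrite integralB_EFin//; [|exact: idth|exact: iclip].
    by rewrite fineB// integrable_fin_num.
  have iR : P.-integrable setT (fun x => (enorm v / ch m `^ (rho - 1))%:E *
      (enorm (dtheta n x) `^ rho)%:E)%E by exact: integrableZl.
  have iL := integrable_linear_comb P _ (fun i => v 0 i) _ iD.
  rewrite mulrA mulrAC -[X in _ <= X * _]/(fine (enorm v / ch m `^ (rho - 1))%:E).
  rewrite -fineM//; last exact: integrable_fin_num.
  rewrite -integralZl// fine_le ?integrable_fin_num//.
  apply: le_integral => // x _; rewrite -EFinM lee_fin.
  by rewrite mulrAC -mulrA dot_clip_error_le.
set K := (X in _ <= X).
have qq m : 0 <= qh m / qbar by rewrite divr_ge0// ltW//; case/andP: (qh01 m).
(* Settles the case [enorm v = 0], in which the norm cannot be cancelled. *)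
have K0 : 0 <= K.
  rewrite !mulr_ge0 ?invr_ge0// sumr_ge0// => k _.
    by rewrite fine_ge0// integral_ge0// => x _; rewrite lee_fin powR_ge0.
  by rewrite divr_ge0// powR_ge0.
have vK : enorm v ^+ 2 <= enorm v * K.
  rewrite vv; apply: (@le_trans _ _ (N%:R^-1 * \sum_n N%:R^-1 * \sum_m (qh m / qbar) *
      (enorm v * (fine (\int[P]_x (enorm (dtheta n x) `^ rho)%:E)%E / ch m `^ (rho - 1))))).
    rewrite ler_wpM2l ?invr_ge0// ler_sum// => n _.
    rewrite ler_wpM2l ?invr_ge0// ler_sum// => m _.
    by rewrite ler_wpM2l.
  (* The moment depends only on [n] and the weight only on [m], so the double average equals
     [enorm v] times the product of averages [K]. *)
  rewrite le_eqVlt; apply/orP; left; apply/eqP.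
  rewrite /K -mulrA mulrCA; congr (_ * _).
  rewrite mulr_suml mulr_sumr; apply: eq_bigr => n _.
  rewrite !mulr_sumr; apply: eq_bigr => m _; ring.
have [v0|v0] := eqVneq (enorm v) 0; first by rewrite v0.
rewrite -(ler_pM2l (_ : 0 < enorm v)) -?expr2//.
by rewrite lt_neqAle eq_sym v0 enorm_ge0.
Qed.
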